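(* Let $n,p$ be positive integers, let $\Phi\in\mathbb{C}^{p\times p}$ be unitary, and let $\phi:\mathbb{R}\to\mathbb{R}$ be a convex function, with derivative $\phi'$. If $\mathcal{A},\mathcal{B}\in\mathbb{C}^{n\times n\times p}$ are $\Phi$-Hermitian, then $$\operatorname{Tr}_{\Phi}\Bigl(\phi(\mathcal{A})-\phi(\mathcal{B})-(\mathcal{A}-\mathcal{B})\,\phi'(\mathcal{B})\Bigr)\ge 0.$$
   Context: For a tensor $\mathcal{X}\in\mathbb{C}^{n\times n\times p}$ with frontal slices $\mathcal{X}^{(k)}$ and a unitary $\Phi\in\mathbb{C}^{p\times p}$, the transformed slices are $\hat{\mathcal{X}}_{\Phi}^{(\omega)}=\sum_{k=1}^p\Phi_{\omega k}\mathcal{X}^{(k)}$, $\omega=1,\dots,p$, and the lifting is $\overline{\mathcal{X}}_{\Phi}=\operatorname{blockdiag}(\hat{\mathcal{X}}_{\Phi}^{(1)},\dots,\hat{\mathcal{X}}_{\Phi}^{(p)})$. A tensor is determined by its lifting. The $\Phi$-trace is $\operatorname{Tr}_\Phi(\mathcal{X})=\operatorname{Tr}(\overline{\mathcal{X}}_{\Phi})$. A tensor $\mathcal{A}$ is $\Phi$-Hermitian if $\overline{\mathcal{A}}_{\Phi}$ is Hermitian. For $\Phi$-Hermitian $\mathcal{A}$ and a real function $f$, $f(\mathcal{A})$ denotes the tensor whose lifting is $f(\overline{\mathcal{A}}_{\Phi})$, by the usual functional calculus for Hermitian matrices. The product of tensors written by juxtaposition is the $\Phi$-product: the tensor whose lifting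 is the product of the liftings. Sums and differences are entrywise. *)

(* Defs.v *)
From HB Require Import structures.
From mathcomp Require Import all_boot all_order all_algebra.
From mathcomp Require Import all_classical all_reals all_analysis.
From mathcomp Require Import complex.

Set Implicit Arguments.
Unset Strict Implicit.
Unset Printing Implicit Defensive.

Import Order.TTheory GRing.Theory Num.Theory.

Local Open Scope classical_set_scope.
Local Open Scope ring_scope.
Local Open Scope complex_scope.

Section DiagonalConjugation.
Variables (F : fieldType) (m : nat).
Implicit Types (g : F -> F) (d e : 'rV[F]_m) (P Q W M E : 'M[F]_m).

Lemma map_diag_intertwine g d e W : diag_mx d *m W = W *m diag_mx e ->
  diag_mx (map_mx g d) *m W = W *m diag_mx (map_mx g e).
Proof.
move=> /matrixP dW; apply/matrixP => i j; move: (dW i j).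
rewrite !mul_diag_mx !mul_mx_diag !mxE.
have [->|W0] := eqVneq (W i j) 0; first by rewrite !mulr0 !mul0r.
by rewrite [in X in X -> _]mulrC => /(mulfI W0) ->; rewrite mulrC.
Qed.

Lemma map_diag_conj_eq g d e P Q : P \in unitmx -> Q \in unitmx ->
  invmx Q *m diag_mx d *m Q = invmx P *m diag_mx e *m P ->
  invmx Q *m diag_mx (map_mx g d) *m Q = invmx P *m diag_mx (map_mx g e) *m P.
Proof.
move=> Pu Qu QP.
have /(map_diag_intertwine g) gE :
    diag_mx d *m (Q *m invmx P) = Q *m invmx P *m diag_mx e.
  transitivity (Q *m (invmx Q *m diag_mx d *m Q) *m invmx P).
    by rewrite !mulmxA mulmxV // mul1mx.
  by rewrite QP !mulmxA mulmxK.
rewrite -[LHS](mulmxKV Pu); congr (_ *m P).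
by rewrite -!mulmxA gE !mulmxA mulVmx // mul1mx.
Qed.

Lemma map_diag_conj_comm g d Q E : Q \in unitmx ->
  comm_mx E (invmx Q *m diag_mx d *m Q) ->
  comm_mx E (invmx Q *m diag_mx (map_mx g d) *m Q).
Proof.
rewrite /comm_mx => Qu EM.
have /(map_diag_intertwine g) :
    diag_mx d *m (Q *m E *m invmx Q) = Q *m E *m invmx Q *m diag_mx d.
  transitivity (Q *m ((invmx Q *m diag_mx d *m Q) *m E) *m invmx Q).
    by rewrite !mulmxA mulmxV // mul1mx.
  by rewrite -EM !mulmxA mulmxK.
move: (map_mx _ d) => f fE.
apply: (can_inj (mulKmx Qu)).
apply: (can_inj (mulmxK (_ : invmx Q \in unitmx))); first by rewrite unitmx_inv.
by rewrite !mulmxA mulmxK // -fE !mulmxA mulmxV // mul1mx.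
Qed.

End DiagonalConjugation.

Section FunctionalCalculus.
Variables (R : realType) (m : nat).
Implicit Types (f : R -> R) (M : 'M[R[i]]_m).

(* The eigenvalues spectral_diag M of a Hermitian M are real, so taking their *)
(* real parts only serves to make the application of f well typed.            *)
Definition hermfun f M : 'M[R[i]]_m :=
  invmx (spectralmx M)
  *m diag_mx (map_mx (fun z => (f (complex.Re z))%:C) (spectral_diag M))
  *m spectralmx M.

(* hermfun does not depend on the diagonalization chosen by the library. *)
Lemma hermfunE f M (P : 'M[R[i]]_m) (d : 'rV[R]_m) : P \is unitarymx ->
  M = invmx P *m diag_mx (map_mx (real_complex R) d) *m P ->
  hermfun f M = invmx P *m diag_mx (map_mx (fun x => (f x)%:C) d) *m P.
Proof.
move=> PU ME.
have /orthomx_spectralP MS : M \is normalmx.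
  by apply/orthomx_spectral_subproof; exists (P, map_mx (real_complex R) d).
have -> : map_mx (fun x => (f x)%:C) d =
    map_mx (fun z => (f (complex.Re z))%:C) (map_mx (real_complex R) d).
  by apply/rowP => j; rewrite !mxE.
apply: (map_diag_conj_eq _ (unitarymx_unit PU) (spectral_unit M)).
exact: etrans (esym MS) ME.
Qed.

Lemma hermfun_comm f M E : M \is hermsymmx ->
  comm_mx E M -> comm_mx E (hermfun f M).
Proof.
move=> /hermitian_normalmx/orthomx_spectralP MS EM.
apply: (map_diag_conj_comm _ (spectral_unit M)).
exact: etrans (etrans (congr1 (mulmx E) (esym MS)) EM) (congr1 (mulmx^~ E) MS).
Qed.
End FunctionalCalculus.

Section PhiTensor.
Variable R : realType.

(* The frontal slices of X : tensor R n p are the matrices X k. *)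
Definition tensor n p := {ffun 'I_p -> 'M[R[i]]_n}.

Variables (n p : nat) (Phi : 'M[R[i]]_p).
Implicit Types (X Y A : tensor n p) (f : R -> R).

Definition tslice X (w : 'I_p) : 'M[R[i]]_n := \sum_(k < p) Phi w k *: X k.

Definition lifting X : 'M[R[i]]_(\sum_(w < p) n) := \mxdiag_w tslice X w.

(* The tensor whose lifting is M, unique when Phi is unitary (lifting_inj),   *)
(* and 0 if M is not a lifting; the latter never happens below, see           *)
(* lifting_tmul and lifting_tfun.                                             *)
Definition of_lifting (M : 'M[R[i]]_(\sum_(w < p) n)) : tensor n p :=
  xget 0 [set X | lifting X = M].

Definition tTr X : R[i] := \tr (lifting X).

Definition tHermitian A : bool := lifting A \is hermsymmx.

Definition tfun f A : tensor n p := of_lifting (hermfun f (lifting A)).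

Definition tmul X Y : tensor n p := of_lifting (lifting X *m lifting Y).

Hypothesis PhiU : Phi \is unitarymx.

Lemma lifting_surj (B : 'I_p -> 'M[R[i]]_n) :
  exists X, lifting X = \mxdiag_w B w.
Proof.
exists [ffun k => \sum_v invmx Phi k v *: B v].
apply: eq_mxdiag => w; rewrite /tslice.
under eq_bigr do rewrite ffunE scaler_sumr.
rewrite exchange_big /=.
transitivity (\sum_v (Phi *m invmx Phi) w v *: B v).
  apply: eq_bigr => v _; rewrite mxE scaler_suml.
  by apply: eq_bigr => k _; rewrite scalerA.
rewrite mulmxV ?unitarymx_unit // (bigD1 w) //= big1 => [|v vw].
  by rewrite mxE eqxx scale1r addr0.
by rewrite mxE eq_sym (negPf vw) scale0r.
Qed.

Lemma lifting_inj : injective lifting.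
Proof.
move=> X Y /eq_mxdiagP XY; apply/ffunP => k.
have tK (Z : tensor n p) : Z k = \sum_w invmx Phi k w *: tslice Z w.
  under eq_bigr do rewrite /tslice scaler_sumr.
  rewrite exchange_big /=.
  transitivity (\sum_v (invmx Phi *m Phi) k v *: Z v).
    rewrite mulVmx ?unitarymx_unit // (bigD1 k) //= big1 => [|v vk].
      by rewrite mxE eqxx scale1r addr0.
    by rewrite mxE eq_sym (negPf vk) scale0r.
  apply: eq_bigr => v _; rewrite mxE scaler_suml.
  by apply: eq_bigr => w _; rewrite scalerA.
by rewrite (tK X) (tK Y); apply: eq_bigr => w _; rewrite XY.
Qed.

Lemma of_liftingK (B : 'I_p -> 'M[R[i]]_n) :
  lifting (of_lifting (\mxdiag_w B w)) = \mxdiag_w B w.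
Proof. exact: (xgetPex 0 (lifting_surj B)). Qed.

Lemma lifting_tmul X Y : lifting (tmul X Y) = lifting X *m lifting Y.
Proof.
rewrite /tmul; suff -> : lifting X *m lifting Y =
    \mxdiag_w (tslice X w *m tslice Y w) by rewrite of_liftingK.
rewrite {2}/lifting /mxdiag mul_mxdiag_mxblock; apply: eq_mxblock => v w.
by case: eqVneq => [->|]; rewrite ?conform_mx_id ?mulmx0.
Qed.

Lemma comm_mxdiag (M : 'M[R[i]]_(\sum_(w < p) n)) :
  (forall w : 'I_p, comm_mx (\mxdiag_v ((v == w)%:R%:M : 'M[R[i]]_n)) M) ->
  M = \mxdiag_w submxblock M w w.
Proof.
move=> cM; apply: etrans (esym (submxblockK M)) _; apply: eq_mxblock => u w.
case: eqVneq => [->|uw]; first by rewrite conform_mx_id.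
have := cM w; rewrite /comm_mx -(submxblockK M).
rewrite mul_mxdiag_mxblock mul_mxblock_mxdiag => /eq_mxblockP/(_ u w).
rewrite eqxx (negPf uw) mulmx1 mxblockK => <-.
by rewrite raddf0 mul0mx.
Qed.

Lemma lifting_tfun f A : tHermitian A ->
  lifting (tfun f A) = hermfun f (lifting A).
Proof.
move=> AH; rewrite /tfun (@comm_mxdiag (hermfun _ _)) ?of_liftingK // => w.
apply: hermfun_comm => //; rewrite /comm_mx /lifting {2 3}/mxdiag.
rewrite mul_mxdiag_mxblock mul_mxblock_mxdiag; apply: eq_mxblock => u v.
case: (eqVneq u v) => [->|_]; last by rewrite mulmx0 mul0mx.
by rewrite !conform_mx_id; rewrite scalar_mxC.
Qed.

End PhiTensor.

(* Main.v *)
Require Import Defs.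
From mathcomp Require Import all_boot all_order all_algebra.
From mathcomp Require Import all_classical all_reals all_analysis.
From mathcomp Require Import complex ring lra.

Import Order.TTheory GRing.Theory Num.Theory.
Import numFieldNormedType.Exports.
Local Open Scope classical_set_scope.
Local Open Scope ring_scope.

(** This is Klein's trace inequality, applied to the liftings.  Two Hermitian
    matrices M and N with eigenvalues a_i and b_j have orthonormal eigenbases;
    let V be the unitary matrix of change of basis between them.  Then
    tr (f(M) g(N)) is the sum over i and j of |V i j|^2 f(a_i) g(b_j)
    ([mxtrace_hermfunM]), so that every trace that occurs is an average of
    scalar quantities with the same nonnegative weights |V i j|^2.  Averaging
    the scalar inequality
      0 <= phi a_i - phi b_j - (a_i - b_j) phi'(b_j),
    which says that the graph of phi lies above its tangents
    ([convex_above_tangent]), gives the inequality between traces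
    ([klein_trace_ge0]).  The tensor operations transfer to the liftings, on
    which the tensor trace is by definition the usual one. *)

(** On the segment from y to x, convexity bounds each difference quotient at y
    by f x - f y; as the step tends to 0 from the right, the quotients tend to
    the directional derivative (x - y) f'(y). *)
Lemma convex_above_tangent (R : realType) (f : R -> R) :
  convex_function [set: convex_lmodType R^o] f ->
  (forall x : R, derivable f x 1) ->
  forall x y : R, 0 <= f x - f y - (x - y) * derive1 f y.
Proof.
move=> f_convex f_derivable x y; rewrite subr_ge0.
have /derivable1_diffP fy := f_derivable y.
have -> : (x - y) * derive1 f y = 'D_(x - y) f y by rewrite deriveE // diff1E.
have := diff_derivable (v := x - y) fy.
rewrite /derivable => /cvg_dnbhs_at_right quotient_cvg.
apply: cvgr_to_le quotient_cvg _.
near=> h.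
have h_gt0 : 0 < h by near: h; exact: nbhs_right_gt.
have h_le1 : h <= 1 by near: h; apply: nbhs_right_le.
have fh : f (h * x + (1 - h) * y) <= h * f x + (1 - h) * f y.
  by apply: (f_convex (Itv01 (ltW h_gt0) h_le1)); rewrite inE.
rewrite /GRing.scale /= ler_pdivrMl //.
have -> : h * (x - y) + y = h * x + (1 - h) * y by ring.
lra.
Unshelve. all: by end_near.
Qed.

(** The weights |V i j|^2 come from V^-1 = V^*, since V is unitary. *)
Lemma mxtrace_unitary_diagM (C : numClosedFieldType) (m : nat)
    (P Q : 'M[C]_m) (d e : 'rV[C]_m) (V := P *m invmx Q) :
  P \is unitarymx -> Q \is unitarymx ->
  \tr ((invmx P *m diag_mx d *m P) *m (invmx Q *m diag_mx e *m Q)) =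
  \sum_i \sum_j `|V i j| ^+ 2 * (d 0 i * e 0 j).
Proof.
move=> PU QU.
have VU : V \is unitarymx.
  by rewrite mul_unitarymx // invmx_unitary // trmxC_unitary.
have QV : Q *m invmx P = invmx V.
  apply: (can_inj (mulmxK (unitarymx_unit VU))).
  rewrite mulVmx ?unitarymx_unit // /V !mulmxA mulmxKV ?unitarymx_unit //.
  by rewrite mulmxV ?unitarymx_unit.
transitivity (\tr ((diag_mx d *m V) *m (diag_mx e *m invmx V))).
  by rewrite -QV -!mulmxA mxtrace_mulC /V !mulmxA.
apply: eq_bigr => i _; rewrite mxE; apply: eq_bigr => j _.
rewrite mul_diag_mx mxE mul_diag_mx mxE invmx_unitary // !mxE normCK.
by rewrite mulrACA mulrC.
Qed.

Section HermitianFunctions.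
Variables (R : realType) (m : nat).
Implicit Types (f g : R -> R) (M N : 'M[R[i]]_m).

Lemma hermfun_id M : M \is hermsymmx -> hermfun id M = M.
Proof.
move=> MH; have /orthomx_spectralP ME := hermitian_normalmx MH.
rewrite [RHS]ME /hermfun; congr (_ *m diag_mx _ *m _).
apply/rowP => j; rewrite mxE RRe_real //.
by have /mxOverP := hermitian_spectral_diag_real MH; apply.
Qed.

Lemma hermfun_cst1 M : hermfun (fun=> 1) M = 1%:M.
Proof.
rewrite /hermfun (_ : map_mx _ _ = const_mx 1) ?diag_const_mx.
  by rewrite mulmx1 mulVmx ?spectral_unit.
by apply/rowP => j; rewrite !mxE.
Qed.

Lemma hermfunM f g M :
  hermfun f M *m hermfun g M = hermfun (fun x => f x * g x) M.
Proof.
rewrite /hermfun; move: (spectralmx M) (spectral_unit M) => Q Qu.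
rewrite -!mulmxA; congr (_ *m _); rewrite (mulmxA Q) mulmxV // mul1mx.
rewrite mulmxA mulmx_diag; congr (diag_mx _ *m _).
by apply/rowP => j; rewrite !mxE rmorphM.
Qed.

Let eigenval M i : R := complex.Re (spectral_diag M 0 i).
Let weight M N i j : R[i] :=
  `|(spectralmx M *m invmx (spectralmx N)) i j| ^+ 2.

Lemma mxtrace_hermfunM f g M N :
  \tr (hermfun f M *m hermfun g N) =
  \sum_i \sum_j weight M N i j * (f (eigenval M i) * g (eigenval N j))%:C%C.
Proof.
rewrite mxtrace_unitary_diagM ?spectral_unitarymx //.
by apply: eq_bigr => i _; apply: eq_bigr => j _;
  congr (_ * _); rewrite !mxE rmorphM.
Qed.

(** The hypothesis makes g y the slope of a line that supports the graph of f
    at y.  Being linear in the products of a function of x and a function of y,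
    it can be averaged over the pairs of eigenvalues with the weights above. *)
Lemma klein_trace_ge0 f g M N : M \is hermsymmx -> N \is hermsymmx ->
  (forall x y, 0 <= f x - f y - (x - y) * g y) ->
  0 <= \tr (hermfun f M - hermfun f N - (M - N) *m hermfun g N).
Proof.
move=> MH NH fg.
(* Each term becomes a function of M times a function of N, so that all four
   traces are sums with the same weights. *)
have -> : hermfun f M - hermfun f N - (M - N) *m hermfun g N =
    hermfun f M *m hermfun (fun=> 1) N - hermfun (fun=> 1) M *m hermfun f N
    - (hermfun id M *m hermfun g N
       - hermfun (fun=> 1) M *m hermfun (fun x => x * g x) N).
  by rewrite -(hermfunM id) !hermfun_cst1 !hermfun_id // mulmx1 !mul1mx mulmxBl.
have trB (X Y Z T : 'M[R[i]]_m) x y z t : \tr X = x -> \tr Y = y ->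
    \tr Z = z -> \tr T = t -> \tr (X - Y - (Z - T)) = x - y - (z - t).
  by move=> <- <- <- <-; rewrite !raddfB.
rewrite (trB _ _ _ _ _ _ _ _ (mxtrace_hermfunM f (fun=> 1) M N)
  (mxtrace_hermfunM (fun=> 1) f M N) (mxtrace_hermfunM id g M N)
  (mxtrace_hermfunM (fun=> 1) (fun x => x * g x) M N)).
rewrite -!sumrB; apply: sumr_ge0 => i _.
rewrite -!sumrB; apply: sumr_ge0 => j _.
rewrite -!mulrBr -!rmorphB mulr_ge0 ?exprn_ge0 // ler0c.
by have := fg (eigenval M i) (eigenval N j); rewrite mulr1 !mul1r -mulrBl.
Qed.

End HermitianFunctions.

Lemma liftingB (R : realType) (n p : nat) (Phi : 'M[R[i]]_p)
    (X Y : tensor R n p) :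
  lifting Phi (X - Y) = lifting Phi X - lifting Phi Y.
Proof.
rewrite /lifting -mxdiagB; apply: eq_mxdiag => w.
rewrite /tslice -sumrB; apply: eq_bigr => k _.
by rewrite !ffunE scalerBr.
Qed.

Theorem theorem3 (R : realType) (n p : nat) (n_gt0 : (0 < n)%N)
    (p_gt0 : (0 < p)%N) (Phi : 'M[R[i]]_p) (PhiU : Phi \is unitarymx)
    (phi : R -> R)
    (phi_convex : convex_function [set: convex_lmodType R^o] phi)
    (phi_derivable : forall x : R, derivable phi x 1)
    (A B : tensor R n p) :
  tHermitian Phi A -> tHermitian Phi B ->
  0 <= tTr Phi (tfun Phi phi A - tfun Phi phi B
                - tmul Phi (A - B) (tfun Phi (derive1 phi) B)).
Proof.
move=> AH BH.
have liftE (X Y Z : tensor R n p) MX MY MZ : lifting Phi X = MX ->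
    lifting Phi Y = MY -> lifting Phi Z = MZ ->
    lifting Phi (X - Y - tmul Phi (A - B) Z) =
    MX - MY - (lifting Phi A - lifting Phi B) *m MZ.
  by move=> <- <- <-; rewrite 2!liftingB lifting_tmul // liftingB.
rewrite /tTr (liftE _ _ _ _ _ _ (lifting_tfun PhiU phi AH)
  (lifting_tfun PhiU phi BH) (lifting_tfun PhiU (derive1 phi) BH)).
by apply: klein_trace_ge0 => //; exact: convex_above_tangent.
Qed.
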